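(* Let $X\subseteq\mathbb{R}^m$, $Y\subseteq\mathbb{R}^n$ be nonempty, compact, convex sets, and for $x\in X$ let $\mathcal{Q}(x)=\inf\{f(y,x): y\in Y\}$. Assume: (H3) $f$ is convex and differentiable on $Y\times X$, and for every $x\in X$ there exists $\alpha(x)>0$ such that $f(y_2,x)\ge f(y_1,x)+(y_2-y_1)^T\nabla_yf(y_1,x)+\frac{\alpha(x)}2\|y_2-y_1\|_2^2$ for all $y_1,y_2\in Y$; (H4) for every $y\in Y$ the function $f(y,\cdot)$ is differentiable on $X$ and for every $x\in X$ there exists $0\le M_1(x)<+\infty$ such that $\|\nabla_xf(y_2,x)-\nabla_xf(y_1,x)\|_2\le M_1(x)\|y_2-y_1\|_2$ for all $y_1,y_2\in Y$. Let $\bar x\in X$, $\varepsilon\ge0$, and let $\hat y(\varepsilon)\in Y$ be an $\varepsilon$-optimal solution of the problem defining $\mathcal{Q}(\bar x)$, i.e. $\mathcal{Q}(\bar x)\ge f(\hat y(\varepsilon),\bar x)-\varepsilon$. Then, setting $$\eta(\varepsilon,\bar x)=\varepsilon+M_1(\bar x)\,\mathrm{Diam}(X)\sqrt{\frac{2\varepsilon}{\alpha(\bar x)}},$$ the affine function $$\mathcal{C}(x):=f(\hat y(\varepsilon),\bar x)-\eta(\varepsilon,\bar x)+\langle\nabla_xf(\hat y(\varepsilon),\bar x),x-\bar x\rangle$$ is a cut for $\mathcal{Q}$ at $\bar x$, i.e. for every $x\in X$ we have $\mathcal{Q}(x)\ge\mathcal{C}(x)$, and the distance $\mathcal{Q}(\bar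 x)-\mathcal{C}(\bar x)$ is at most $\eta(\varepsilon,\bar x)$; or, equivalently, $\nabla_xf(\hat y(\varepsilon),\bar x)\in\partial_{\eta(\varepsilon,\bar x)}\mathcal{Q}(\bar x)$.
   Context: $f:\mathbb{R}^n\times\mathbb{R}^m\to\mathbb{R}\cup\{+\infty\}$ is lower semicontinuous, proper and convex (standing assumption). $\mathrm{Diam}(X)=\max_{x,x'\in X}\|x-x'\|_2$. For $\eta\ge0$, $s\in\partial_\eta\mathcal{Q}(\bar x)$ means $\mathcal{Q}(x)\ge\mathcal{Q}(\bar x)+\langle s,x-\bar x\rangle-\eta$ for all $x\in X$. *)

(* Defs.v *)
From HB Require Import structures.
From mathcomp Require Import all_boot all_order all_algebra.
From mathcomp Require Import all_classical all_reals all_analysis.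

Set Implicit Arguments.
Unset Strict Implicit.
Unset Printing Implicit Defensive.

Import Order.TTheory GRing.Theory Num.Theory.
Import numFieldNormedType.Exports.

Local Open Scope classical_set_scope.
Local Open Scope ring_scope.

(* The library norm `|v| on row vectors is the sup norm; the Euclidean norm is
   [norm2]. The two norms are equivalent, so the library notions of compactness
   and (Frechet) differentiability are the Euclidean ones. *)
Definition dot (R : realType) (k : nat) (u v : 'rV[R]_k) : R :=
  \sum_(i < k) u 0 i * v 0 i.

Definition norm2 (R : realType) (k : nat) (v : 'rV[R]_k) : R :=
  Num.sqrt (dot v v).

(* The supremum is a maximum when [X] is nonempty and compact. *)
Definition Diam (R : realType) (k : nat) (X : set 'rV[R]_k) : R :=
  sup [set norm2 (p.1 - p.2) | p in X `*` X].

(* Functions with values in R U {+oo} are functions into [\bar R] that never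
   take the value -oo. With the convention 0 * +oo = 0 of [\bar R], the
   inequality in [econvex_on] is trivial for t = 0 and t = 1. *)
Definition econvex_on (R : realType) (E : lmodType R) (D : set E)
    (f : E -> \bar R) : Prop :=
  forall (x y : E) (t : R), D x -> D y -> 0 <= t <= 1 ->
    (f (t *: x + (1 - t) *: y)%R <= t%:E * f x + (1 - t)%:E * f y)%E.

Definition eproper (R : realType) (E : Type) (f : E -> \bar R) : Prop :=
  (forall x, f x != -oo%E) /\ (exists x, f x != +oo%E).

(* Differentiability at [p] of an extended-valued function: it is finite on a
   neighbourhood of [p] and its real-valued version is differentiable at [p]. *)
Definition edifferentiable (R : realType) (E : normedModType R)
    (f : E -> \bar R) (p : E) : Prop :=
  (\forall q \near p, f q \is a fin_num) /\
  differentiable (fine \o f : E -> R^o) p.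

Definition gradient (R : realType) (k : nat) (g : 'rV[R]_k -> \bar R)
    (p : 'rV[R]_k) : 'rV[R]_k :=
  \row_(i < k) 'D_(delta_mx 0 i) (fine \o g : 'rV[R]_k -> R^o) p.

Section two_variables.
Context (R : realType) (n m : nat).
Implicit Types (f : 'rV[R]_n * 'rV[R]_m -> \bar R).

Definition grad_y f (y : 'rV[R]_n) (x : 'rV[R]_m) : 'rV[R]_n :=
  gradient (fun y' => f (y', x)) y.

Definition grad_x f (y : 'rV[R]_n) (x : 'rV[R]_m) : 'rV[R]_m :=
  gradient (fun x' => f (y, x')) x.

Definition value_function f (Y : set 'rV[R]_n) (x : 'rV[R]_m) : \bar R :=
  ereal_inf [set f (y, x) | y in Y].

End two_variables.

Definition eta_subgradient (R : realType) (m : nat) (X : set 'rV[R]_m)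
    (Q : 'rV[R]_m -> \bar R) (eta : R) (xbar s : 'rV[R]_m) : Prop :=
  forall x, X x -> (Q xbar + (dot s (x - xbar)%R)%:E - eta%:E <= Q x)%E.

(* Main.v *)
Require Import Defs.
From HB Require Import structures.
From mathcomp Require Import all_boot all_order all_algebra.
From mathcomp Require Import all_classical all_reals all_analysis.
From mathcomp Require Import ring lra.

Import Order.TTheory GRing.Theory Num.Theory.
Import numFieldNormedType.Exports.

Local Open Scope classical_set_scope.
Local Open Scope ring_scope.

(** The function [f] is jointly convex, so at a minimizer [ybar] of
    [f (-, xbar)] over [Y] the tangent plane of [f] at [(ybar, xbar)] lies below
    [f] on [Y `*` X] ([econvex_gradient_inequality]). Its slope in the [y]
    variable is nonnegative towards every point of [Y], because [ybar] is optimal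
    ([derive_ge0]); dropping that term and minimizing over [y] gives
      [Q x >= Q xbar + <grad_x f ybar xbar, x - xbar>],
    the exact cut built from the exact solution.

    It remains to replace [ybar] by the approximate solution [yhat]. Replacing
    the value costs [eps], since [f (yhat, xbar) - eps <= Q xbar]. Replacing the
    slope costs [<grad_x f yhat xbar - grad_x f ybar xbar, x - xbar>], which
    Cauchy-Schwarz and the Lipschitz bound on [grad_x f] make at most
    [M1 xbar * norm2 (yhat - ybar) * Diam X]. Finally, strong convexity between
    [ybar] and [yhat], with the optimality of [ybar] once more, gives
    [alpha / 2 * norm2 (yhat - ybar) ^+ 2 <= eps], hence
    [norm2 (yhat - ybar) <= sqrt (2 * eps / alpha)]. The two costs add up to the
    error [eta].

    The hypotheses speak of the partial gradients whereas the convexity argument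
    needs the derivative of [f] along a joint direction [(v, w)]; the link
    between the two is [derive_pairE]. *)

Section euclidean.
Context {R : realType} {k : nat}.
Implicit Types u v w : 'rV[R]_k.

Lemma dotC u v : dot u v = dot v u.
Proof. by apply: eq_bigr => i _; rewrite mulrC. Qed.

Lemma dotBl u v w : dot (u - v) w = dot u w - dot v w.
Proof.
by rewrite -sumrB; apply: eq_bigr => i _; rewrite !mxE mulrBl.
Qed.

Lemma dot0r u : dot u 0 = 0.
Proof. by apply: big1 => i _; rewrite mxE mulr0. Qed.

Lemma dotvv_ge0 u : 0 <= dot u u.
Proof. by apply: sumr_ge0 => i _; rewrite -expr2 sqr_ge0. Qed.

Lemma norm2_ge0 u : 0 <= norm2 u.
Proof. exact: sqrtr_ge0. Qed.

Lemma norm2_sqr u : norm2 u ^+ 2 = dot u u.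
Proof. by rewrite sqr_sqrtr ?dotvv_ge0. Qed.

Lemma dot_comb_ge0 u v (a b : R) :
  0 <= a ^+ 2 * dot u u - 2 * a * b * dot u v + b ^+ 2 * dot v v.
Proof.
have := dotvv_ge0 (a *: u - b *: v); congr (_ <= _).
rewrite /dot !mulr_sumr -sumrB -big_split /=.
by apply: eq_bigr => i _; rewrite !mxE; ring.
Qed.

(** Cauchy-Schwarz, from the nonnegativity of the squared norm of well-chosen
    combinations of [u] and [v]. *)
Lemma dot_le_norm2 u v : dot u v <= norm2 u * norm2 v.
Proof.
have nu := norm2_ge0 u; have nv := norm2_ge0 v.
have [/ltW uv0|uv0] := ltP (dot u v) 0.
  by rewrite (le_trans uv0) ?mulr_ge0.
rewrite -ler_sqr ?nnegrE ?mulr_ge0// exprMn !norm2_sqr.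
have u0 := dotvv_ge0 u; have v0 := dotvv_ge0 v.
have [vv0|vv0] := ltP 0 (dot v v).
  (* dot v v times the component of u orthogonal to v *)
  have := dot_comb_ge0 u v (dot v v) (dot u v).
  rewrite -subr_ge0 => H; rewrite -subr_ge0 -(pmulr_rge0 _ vv0).
  by congr (_ <= _): H; ring.
have vE : dot v v = 0 by apply/le_anti/andP.
(* when dot v v = 0 this combination has squared norm
   - (dot u u + 2) * dot u v ^+ 2, which forces dot u v = 0 *)
have := dot_comb_ge0 u v (dot u v) (dot u u + 1).
rewrite vE !mulr0 addr0; nra.
Qed.

Lemma norm2_continuous : continuous (@norm2 R k).
Proof.
have dot_cont : continuous (fun u : 'rV[R]_k => dot u u).
  apply: continuous_big => [|i _ u]; first exact: add_continuous.
  by apply: continuousM; exact: coord_continuous.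
by move=> u; exact: (continuous_comp (dot_cont u) (@sqrt_continuous R _)).
Qed.

(** Compactness matters: the supremum of an unbounded set of reals is a
    default value, not an upper bound. *)
Lemma norm2B_le_Diam (X : set 'rV[R]_k) u v :
  compact X -> X u -> X v -> norm2 (u - v) <= Diam X.
Proof.
move=> cX Xu Xv; have uvX : (X `*` X) (u, v) by [].
apply: sup_upper_bound; last by exists (u, v).
apply: compact_has_sup; first by exists (norm2 (u - v)); exists (u, v).
apply: continuous_compact; last exact: compact_setX.
apply: continuous_subspaceT => p.
apply: (@continuous_comp _ _ _ (fun p : 'rV[R]_k * 'rV[R]_k => p.1 - p.2));
  last exact: norm2_continuous.
by apply: cvgB; [exact: cvg_fst|exact: cvg_snd].
Qed.

(** Partial derivatives determine all directional derivatives only for a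
    differentiable function, through linearity of the differential. *)
Lemma dot_gradient (g : 'rV[R]_k -> \bar R) (p v : 'rV[R]_k) :
  differentiable (fine \o g : _ -> R^o) p ->
  dot (gradient g p) v = 'D_v (fine \o g : _ -> R^o) p.
Proof.
move=> dg; rewrite deriveE// {2}(row_sum_delta v) linear_sum.
by apply: eq_bigr => i _; rewrite linearZ /= mxE deriveE// mulrC.
Qed.

End euclidean.

Section directional_derivatives.
Context {R : realType} {E : normedModType R}.

(** Bounding the one-sided difference quotients is enough, because a derivable
    function has its derivative as right limit; only points ahead of [p] are
    controlled when [p] lies on the boundary of a convex set. *)
Lemma derive_le (F : E -> R^o) (p v : E) (c : R) : derivable F p v ->
  (forall t : R, 0 < t <= 1 -> F (p + t *: v) - F p <= t * c) ->
  'D_v F p <= c.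
Proof.
move=> dF Fc; rewrite /derive cvg_at_rightE; last exact: dF.
apply: limr_le; first by apply/cvg_ex; eexists; exact: cvg_dnbhs_at_right dF.
near=> t.
have t0 : 0 < t by near: t; exact: nbhs_right_gt.
have t1 : t <= 1 by near: t; apply: nbhs_right_le.
rewrite /= [_ *: _]mulrC ler_pdivrMr// mulrC addrC.
by rewrite [_ + p]addrC [X in X <= _]addrC Fc// t0.
Unshelve. all: by end_near. Qed.

(** The first-order optimality condition at a minimizer over a segment. *)
Lemma derive_ge0 (F : E -> R^o) (p v : E) : derivable F p v ->
  (forall t : R, 0 < t <= 1 -> F p <= F (p + t *: v)) -> 0 <= 'D_v F p.
Proof.
move=> dF Fmin; rewrite -oppr_le0 -deriveN//.
apply: derive_le => [|t t01]; first exact: derivableN.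
by rewrite mulr0 opprK addrC subr_le0 Fmin.
Qed.

Lemma convex_set_segment (D : set E) (x y : E) (t : R) :
  convex_set D -> D x -> D y -> 0 < t <= 1 -> D (x + t *: (y - x)).
Proof.
move=> cD Dx Dy /andP[t0 t1].
have := cD y x (Itv01 (ltW t0) t1) (mem_set Dy) (mem_set Dx).
move/set_mem; congr D.
rewrite /conv /= scalerBr scalerBl scale1r addrCA; congr (_ + _).
Qed.

(** A convex function lies above its tangent: by convexity the difference
    quotients of [f] from [p] towards [q] are at most [f q - f p]. *)
Lemma econvex_gradient_inequality (D : set E) (f : E -> \bar R) (p q : E) :
  convex_set D -> econvex_on D f -> (forall z, D z -> f z \is a fin_num) ->
  D p -> D q -> differentiable (fine \o f : E -> R^o) p ->
  fine (f p) + 'D_(q - p) (fine \o f : E -> R^o) p <= fine (f q).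
Proof.
move=> cD cf ffin Dp Dq df; rewrite -lerBrDl.
apply: derive_le => [|t t01]; first exact: diff_derivable.
have Dt := convex_set_segment _ _ _ _ cD Dp Dq t01.
have t01' : 0 <= t <= 1 by case/andP: t01 => /ltW -> ->.
have := cf q p t Dq Dp t01'.
have -> : t *: q + (1 - t) *: p = p + t *: (q - p).
  by rewrite scalerBr scalerBl scale1r addrCA.
rewrite -(fineK (ffin _ Dp)) -(fineK (ffin _ Dq)) -(fineK (ffin _ Dt)).
by rewrite -!EFinM -EFinD lee_fin /=; lra.
Qed.

End directional_derivatives.

Lemma convex_setX {R : realType} {E F : normedModType R}
    (A : set E) (B : set F) :
  convex_set A -> convex_set B -> convex_set (A `*` B).
Proof.
move=> cA cB p q t /set_mem[Ap Bp] /set_mem[Aq Bq]; apply/mem_set; split.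
- by apply/set_mem/cA; exact/mem_set.
- by apply/set_mem/cB; exact/mem_set.
Qed.

Section partial_gradients.
Context {R : realType} {n m : nat}.
Variables (f : 'rV[R]_n * 'rV[R]_m -> \bar R) (y : 'rV[R]_n) (x : 'rV[R]_m).
Let F : 'rV[R]_n * 'rV[R]_m -> R^o := fine \o f.
Hypothesis dF : differentiable F (y, x).

Lemma differentiable_fst : differentiable (fun y' => F (y', x)) y.
Proof. by apply: (@differentiable_comp _ _ _ _ (fun y' => (y', x)) F). Qed.

Lemma dot_grad_y v : dot (grad_y f y x) v = 'D_(v, 0) F (y, x).
Proof.
rewrite dot_gradient; last exact: differentiable_fst.
rewrite /derive; apply: (congr1 (fun G : R -> R^o => lim (G @ 0^'))).
apply/funext => h /=.
by congr (_ *: (F (_, _) - _)); rewrite /= scaler0 add0r.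
Qed.

Lemma dot_grad_x v : dot (grad_x f y x) v = 'D_(0, v) F (y, x).
Proof.
rewrite dot_gradient; last first.
  by apply: (@differentiable_comp _ _ _ _ (fun x' => (y, x')) F).
rewrite /derive; apply: (congr1 (fun G : R -> R^o => lim (G @ 0^'))).
apply/funext => h /=.
by congr (_ *: (F (_, _) - _)); rewrite /= scaler0 add0r.
Qed.

(** The differential at [(y, x)] is additive, so a joint direction splits into
    its two coordinate directions. *)
Lemma derive_pairE v w :
  'D_(v, w) F (y, x) = dot (grad_y f y x) v + dot (grad_x f y x) w.
Proof.
rewrite dot_grad_y dot_grad_x !deriveE// -linearD.
by congr ('d F _ (_, _)); rewrite ?addr0 ?add0r.
Qed.

End partial_gradients.

Theorem proposition3p5 (R : realType) (n m : nat)
    (f : 'rV[R]_n * 'rV[R]_m -> \bar R)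
    (f_lsc : lower_semicontinuous f)
    (f_proper : eproper f)
    (f_convex : econvex_on setT f)
    (X : set 'rV[R]_m) (Y : set 'rV[R]_n)
    (X0 : X !=set0) (X_compact : compact X) (X_convex : convex_set X)
    (Y0 : Y !=set0) (Y_compact : compact Y) (Y_convex : convex_set Y)
    (alpha M1 : 'rV[R]_m -> R)
    (H3_convex : econvex_on (Y `*` X) f)
    (H3_diff : forall p, (Y `*` X) p -> edifferentiable f p)
    (H3_strong : forall x, X x -> 0 < alpha x /\
       forall y1 y2, Y y1 -> Y y2 ->
         (f (y1, x) + (dot (y2 - y1)%R (grad_y f y1 x))%:E
            + (alpha x / 2 * norm2 (y2 - y1) ^+ 2)%:E <= f (y2, x))%E)
    (H4_diff : forall y, Y y -> forall x, X x ->
       edifferentiable (fun x' => f (y, x')) x)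
    (H4_lip : forall x, X x -> 0 <= M1 x /\
       forall y1 y2, Y y1 -> Y y2 ->
         norm2 (grad_x f y2 x - grad_x f y1 x) <= M1 x * norm2 (y2 - y1))
    (xbar : 'rV[R]_m) (xbarX : X xbar)
    (eps : R) (eps_ge0 : 0 <= eps)
    (yhat : 'rV[R]_n) (yhatY : Y yhat)
    (yhat_opt : (f (yhat, xbar) - eps%:E <= value_function f Y xbar)%E) :
  let Q := value_function f Y in
  let eta := eps + M1 xbar * Diam X * Num.sqrt (2 * eps / alpha xbar) in
  let C := fun x : 'rV[R]_m =>
    (f (yhat, xbar) - eta%:E + (dot (grad_x f yhat xbar) (x - xbar)%R)%:E)%E in
  ((forall x, X x -> (C x <= Q x)%E) /\ (Q xbar - C xbar <= eta%:E)%E) /\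
  eta_subgradient X Q eta xbar (grad_x f yhat xbar).
Proof.
move=> Q eta C.
pose F : 'rV[R]_n * 'rV[R]_m -> R^o := fine \o f.
have ffin p : (Y `*` X) p -> f p \is a fin_num.
  by move=> /H3_diff[/nbhs_singleton].
have dF p : (Y `*` X) p -> differentiable F p by move=> /H3_diff[].
have fE y x : Y y -> X x -> f (y, x) = (F (y, x))%:E.
  by move=> Yy Xx; rewrite fineK// ffin.
have [ybar /set_mem Yybar ybar_min] :
    exists2 y, y \in Y & forall y', y' \in Y -> F (y, xbar) <= F (y', xbar).
  apply: (@compact_EVT_min _ _ (fun y => F (y, xbar))) => //.
  apply: continuous_in_subspaceT => y /set_mem Yy.
  apply/differentiable_continuous/differentiable_fst.
  exact: dF.
have dFbar : differentiable F (ybar, xbar) by exact: dF.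
have opt y : Y y -> 0 <= dot (grad_y f ybar xbar) (y - ybar).
  move=> Yy; rewrite dot_grad_y//.
  apply: derive_ge0 => [|t t01]; first exact: diff_derivable.
  have -> : (ybar, xbar) + t *: (y - ybar, 0) = (ybar + t *: (y - ybar), xbar).
    by congr (_, _); rewrite /= scaler0 addr0.
  by apply: ybar_min; apply/mem_set; exact: convex_set_segment t01.
have grad_ineq y x : Y y -> X x ->
    F (ybar, xbar) + dot (grad_x f ybar xbar) (x - xbar) <= F (y, x).
  move=> Yy Xx.
  have cvxD : convex_set (Y `*` X) by exact: convex_setX.
  have : F (ybar, xbar) + 'D_((y, x) - (ybar, xbar)) F (ybar, xbar) <= F (y, x).
    exact: (econvex_gradient_inequality (Y `*` X)).
  have -> : (y, x) - (ybar, xbar) = (y - ybar, x - xbar) by [].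
  rewrite derive_pairE// addrCA => /(le_trans _); apply.
  by rewrite lerDr opt.
have eps_opt : F (yhat, xbar) - eps <= F (ybar, xbar).
  have : (f (yhat, xbar) - eps%:E <= f (ybar, xbar))%E.
    by apply: le_trans yhat_opt _; apply: ereal_inf_lbound; exists ybar.
  by rewrite !fE// -EFinB lee_fin.
have [alpha_gt0 strong] := H3_strong _ xbarX.
have [M1_ge0 lip] := H4_lip _ xbarX.
have dist_le : norm2 (yhat - ybar) <= Num.sqrt (2 * eps / alpha xbar).
  rewrite -[leLHS]ger0_norm ?norm2_ge0// -sqrtr_sqr.
  rewrite ler_wsqrtr// ler_pdivlMr//.
  have := strong _ _ Yybar yhatY.
  rewrite !fE// -!EFinD lee_fin dotC.
  by have := opt _ yhatY; lra.
have err x : X x -> dot (grad_x f yhat xbar - grad_x f ybar xbar) (x - xbar)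
    <= M1 xbar * Diam X * Num.sqrt (2 * eps / alpha xbar).
  move=> Xx; apply: le_trans (dot_le_norm2 _ _) _.
  rewrite mulrAC; apply: ler_pM; rewrite ?norm2_ge0 ?norm2B_le_Diam//.
  by apply: le_trans (lip _ _ Yybar yhatY) _; rewrite ler_wpM2l.
have cut x : X x -> (C x <= Q x)%E.
  move=> Xx; apply: le_ereal_inf_tmp => _ [y Yy <-].
  rewrite /C !fE// -EFinB -EFinD lee_fin.
  have := err x Xx; rewrite dotBl /eta.
  by have := grad_ineq y x Yy Xx; lra.
have Qxbar_le : (Q xbar <= f (yhat, xbar))%E.
  by apply: ereal_inf_lbound; exists yhat.
split; [split=> //|].
- rewrite /C subrr dot0r adde0.
  rewrite fE// -EFinB leeBlDr// -EFinD addrC subrK.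
  by rewrite -fE.
- move=> x Xx; apply: le_trans (cut x Xx).
  rewrite /C addeAC; apply: leeD => //.
  exact: leeD.
Qed.
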